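(* Let $p,q\in\mathbb{N}$ be co-prime and $\theta=\tan^{-1}(p/q)$. Then the measure $\mu_\theta$ is singular with respect to Lebesgue measure.
   Context: Throughout, $p,q\in\mathbb{N}$ are co-prime with $p/q\in[0,1]$. Let $D=\{0,1,p/q\}$. The measure $\mu_\theta$ is the unique Borel probability measure on $\mathbb{R}$ satisfying $\mu_\theta(A)=\tfrac13\big(\mu_\theta(2A)+\mu_\theta(2A-1)+\mu_\theta(2A-p/q)\big)$ for all Borel $A$; equivalently, $\mu_\theta$ is the distribution of $\sum_{i\ge1}a_i2^{-i}$ where $a_1,a_2,\dots$ are i.i.d. uniformly distributed on $D$. (Equivalently, it is the push-forward of the natural uniform (fair Bernoulli) measure on the Sierpinski triangle with vertices $(0,0),(1,0),(0,1)$ under the projection $(x,y)\mapsto x+\frac pq y$.) *)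

(* Defs.v *)
From HB Require Import structures.
From mathcomp Require Import all_boot all_order all_algebra.
From mathcomp Require Import all_classical all_reals all_analysis.
Set Implicit Arguments. Unset Strict Implicit. Unset Printing Implicit Defensive.
Import Order.TTheory GRing.Theory Num.Theory.
Local Open Scope classical_set_scope.
Local Open Scope ring_scope.

Definition dil2 (R : realType) (c : R) (A : set R) : set R :=
  [set 2 * x - c | x in A].

(* mu is a solution of the self-similarity equation defining mu_theta,
   with digit set D = {0, 1, c}, c = p/q :
   mu(A) = 1/3 (mu(2A) + mu(2A-1) + mu(2A-c)) for all Borel A. *)
Definition self_similar_measure (R : realType) (c : R)
  (mu : probability R R) : Prop :=
  forall A : set R, measurable A ->
    mu A = (((3%:R)^-1)%:E *
           (mu (dil2 0 A) + mu (dil2 1 A) + mu (dil2 c A)))%E.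

Definition singular_wrt_lebesgue (R : realType) (mu : probability R R) : Prop :=
  exists A : set R, [/\ measurable A, (@lebesgue_measure R) A = 0%E
                     & mu (~` A) = 0%E].

(* Main.v *)
(** Let [w = 2 pi q] and let [B] be the set of points [x] at which the averages
    of [cos (w 2^k x)] and [sin (w 2^k x)] over [k < 2^j] are square summable
    in [j].  By orthogonality [B] is of full Lebesgue measure.  Since
    [w d] is a multiple of [2 pi] for each digit [d], [B] is invariant under the
    maps [x |-> (x + d) / 2], so the restriction of [mu] to [B] is again
    self-similar and its Fourier transform takes the same value at all the
    frequencies [w 2^k]; by bounded convergence of the averages this value is [0].
    On the other hand the factors [(1 + e^(i w / 2^m) + e^(i w c / 2^m)) / 3]
    relating the transform at [w / 2^(m-1)] to the one at [w / 2^m] do not vanish,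
    hence the transform is [0] at each [w / 2^m], and letting [m] tend to infinity
    gives [mu B = 0]. *)
Require Import Defs.
From HB Require Import structures.
From mathcomp Require Import all_boot all_order all_algebra.
From mathcomp Require Import all_classical all_reals all_analysis.
From mathcomp Require Import measurable_realfun ring lra.
Import Order.TTheory GRing.Theory Num.Theory.
Import numFieldNormedType.Exports.
Local Open Scope classical_set_scope.
Local Open Scope ring_scope.

(** * Periodicity of the trigonometric functions, integrals of waves and of finite sums *)

Lemma cosD2pin (R : realType) (x : R) (n : nat) :
  cos (x + 2 * pi * n%:R) = cos x.
Proof.
have -> : 2 * pi * n%:R = (pi *+ 2) *+ n :> R by rewrite -mulr_natr -(mulr_natr pi 2); ring.
exact/periodicn/cosD2pi.
Qed.

Lemma sinD2pin (R : realType) (x : R) (n : nat) :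
  sin (x + 2 * pi * n%:R) = sin x.
Proof.
have -> : 2 * pi * n%:R = (pi *+ 2) *+ n :> R by rewrite -mulr_natr -(mulr_natr pi 2); ring.
exact/periodicn/sinD2pi.
Qed.

Lemma sin2pin (R : realType) (n : nat) : sin (2 * pi * n%:R) = 0 :> R.
Proof. by rewrite -[X in sin X]add0r sinD2pin sin0. Qed.

Lemma cos2pin (R : realType) (n : nat) : cos (2 * pi * n%:R) = 1 :> R.
Proof. by rewrite -[X in cos X]add0r cosD2pin cos0. Qed.

Lemma continuous_cos_affine (R : realType) (t b : R) :
  continuous (fun x => cos (t * x - b)).
Proof.
move=> x; apply: (@continuous_comp _ _ _ (fun x => t * x - b)).
  by apply: cvgB; [apply: cvgM; [exact: cvg_cst|exact: cvg_id]|exact: cvg_cst].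
exact: continuous_cos.
Qed.

(** The primitive [t^-1 * sin (t * x - b)] increases by [2 * t^-1 * sin (t * M) * cos b] over the
    interval. This is the source of the orthogonality of the waves. *)
Lemma integral_cos_affine_eq0 (R : realType) (t b M : R) :
  t != 0 -> 0 < M -> sin (t * M) = 0 ->
  \int[lebesgue_measure]_(x in `[- M, M]) cos (t * x - b) = 0.
Proof.
move=> t0 M0 tM.
pose l : R -> R := t \*: id - cst b.
pose F : R -> R := t^-1 \*: (sin \o l).
have dF (x : R) : is_derive x 1 F (cos (t * x - b)).
  have dl : is_derive x (1 : R) l (t *: 1 - 0).
    by apply: is_deriveB; apply: is_deriveZ; exact: is_derive_id.
  have ds : is_derive x (1 : R) (sin \o l) (cos (l x) * (t *: 1 - 0)).
    by apply: is_derive1_comp; exact: is_derive_sin.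
  have dZ := is_deriveZ t^-1 ds.
  apply: (is_derive_eq dZ).
  by rewrite /GRing.scale/= mulr1 subr0 mulrCA mulVf// mulr1.
rewrite /Rintegral (@continuous_FTC2 _ _ F).
- rewrite -EFinB /=.
  have FE x : F x = t^-1 * sin (t * x - b) by [].
  rewrite !FE mulrN -mulrBr !sinB sinN cosN tM; ring.
- by rewrite gtrN.
- exact/continuous_subspaceT/continuous_cos_affine.
- split => [x _||].
  + exact: (@ex_derive _ _ _ _ _ _ _ (dF x)).
  + apply: cvg_at_right_filter; apply: differentiable_continuous.
    apply/derivable1_diffP; apply: (@ex_derive _ _ _ _ _ _ _ (dF _)).
  + apply: cvg_at_left_filter; apply: differentiable_continuous.
    apply/derivable1_diffP; apply: (@ex_derive _ _ _ _ _ _ _ (dF _)).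
- by move=> x _; rewrite derive1E; apply: (@derive_val _ _ _ _ _ _ _ (dF x)).
Qed.

Lemma continuous_integrable_itv (R : realType) (a b : R) (F : R -> R) :
  continuous F -> lebesgue_measure.-integrable `[a, b] (EFin \o F).
Proof.
by move=> cF; apply: continuous_compact_integrable;
  [exact: segment_compact|exact: continuous_subspaceT].
Qed.

Lemma continuous_sumr (R : realType) (I : Type) (s : seq I) (F : I -> R -> R) :
  (forall i, continuous (F i)) -> continuous (fun x => \sum_(i <- s) F i x).
Proof.
move=> cF; elim: s => [|i s IH].
  by under eq_fun do rewrite big_nil; exact: cst_continuous.
under eq_fun do rewrite big_cons.
by move=> x; apply: cvgD; [exact: cF|exact: IH].
Qed.

Lemma integrable_sumr d (T : measurableType d) (R : realType)
    (mu : {measure set T -> \bar R}) (D : set T) (I : Type) (s : seq I)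
    (F : I -> T -> R) :
  measurable D -> (forall i, mu.-integrable D (EFin \o F i)) ->
  mu.-integrable D (EFin \o (fun x => \sum_(i <- s) F i x)).
Proof.
move=> mD iF; elim: s => [|i s IH].
  by under [_ \o _]eq_fun do rewrite /= big_nil; exact: integrable0.
under [_ \o _]eq_fun do rewrite /= big_cons EFinD.
by apply: integrableD => //; exact: iF.
Qed.

Lemma Rintegral_sumr d (T : measurableType d) (R : realType)
    (mu : {measure set T -> \bar R}) (D : set T) (I : Type) (s : seq I)
    (F : I -> T -> R) :
  measurable D -> (forall i, mu.-integrable D (EFin \o F i)) ->
  \int[mu]_(x in D) (\sum_(i <- s) F i x) = \sum_(i <- s) \int[mu]_(x in D) F i x.
Proof.
move=> mD iF; elim: s => [|i s IH].
  rewrite big_nil; under eq_Rintegral do rewrite big_nil.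
  by rewrite Rintegral_cst// mul0r.
rewrite big_cons -IH.
under eq_Rintegral do rewrite big_cons.
by rewrite RintegralD//; exact: integrable_sumr.
Qed.

(** * Dyadic means, their square summability, and its invariance under halving maps *)

Definition dyadic_mean {R : realType} (f : R -> R) (j : nat) (x : R) : R :=
  (\sum_(k < 2 ^ j) f (2 ^+ k * x)) / 2 ^+ j.

(* The means are taken along [2 ^ j] so that the squares, of integral
   [O(2 ^- j)] on bounded intervals, are summable. *)
Definition dyadic_mean_summable {R : realType} (f : R -> R) : set R :=
  [set x | (\sum_(j <oo) (dyadic_mean f j x ^+ 2)%:E < +oo)%E].

Lemma continuous_dilation (R : realType) (f : R -> R) (a : R) :
  continuous f -> continuous (fun x => f (a * x)).
Proof.
move=> cf x; apply: (@continuous_comp _ _ _ (fun x => a * x)); last exact: cf.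
by apply: cvgM; [exact: cvg_cst|exact: cvg_id].
Qed.

Lemma continuous_dyadic_mean (R : realType) (f : R -> R) (j : nat) :
  continuous f -> continuous (dyadic_mean f j).
Proof.
move=> cf x; apply: cvgM; last exact: cvg_cst.
by apply: continuous_sumr => k; exact: continuous_dilation.
Qed.

Lemma dyadic_mean_norm_le1 (R : realType) (f : R -> R) (j : nat) (x : R) :
  (forall x, `|f x| <= 1) -> `|dyadic_mean f j x| <= 1.
Proof.
move=> f1; rewrite /dyadic_mean normrM normfV (@ger0_norm _ (2 ^+ j)) ?exprn_ge0//.
rewrite ler_pdivrMr ?exprn_gt0// mul1r (le_trans (ler_norm_sum _ _ _))//.
rewrite (le_trans (ler_sum _ (fun k _ => f1 _)))// sumr_const card_ord.
by rewrite -natrX.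
Qed.

Lemma measurable_dyadic_mean (R : realType) (f : R -> R) (j : nat) :
  continuous f -> measurable_fun [set: R] (dyadic_mean f j).
Proof.
by move=> cf; apply: continuous_measurable_fun; exact: continuous_dyadic_mean.
Qed.

Lemma measurable_sum_dyadic_mean (R : realType) (f : R -> R) (D : set R) :
  measurable D -> continuous f ->
  measurable_fun D (fun x => \sum_(j <oo) (dyadic_mean f j x ^+ 2)%:E)%E.
Proof.
move=> mD cf; apply: ge0_emeasurable_sum => [k x _ _|k _].
  by rewrite lee_fin sqr_ge0.
apply/measurable_EFinP; apply: measurable_funX.
by apply: measurable_funTS; exact: measurable_dyadic_mean.
Qed.

Lemma measurable_dyadic_mean_summable (R : realType) (f : R -> R) :
  continuous f -> measurable (dyadic_mean_summable f).
Proof.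
move=> cf; rewrite /dyadic_mean_summable -[X in measurable X]setTI.
apply: emeasurable_fun_infty_o => //; exact: measurable_sum_dyadic_mean.
Qed.

(** When the square is expanded, orthogonality leaves only the [2 ^ j] diagonal terms. Each is at
    most the length [2 * M], against a normalization by [4 ^ j]. *)
Lemma Rintegral_dyadic_mean_sqr_le (R : realType) (f : R -> R) (M : R) (j : nat) :
  continuous f -> (forall x, `|f x| <= 1) -> 0 < M ->
  (forall k l : nat, k != l -> \int[lebesgue_measure]_(x in `[- M, M])
     (f (2 ^+ k * x) * f (2 ^+ l * x)) = 0) ->
  \int[lebesgue_measure]_(x in `[- M, M]) (dyadic_mean f j x ^+ 2) <=
  2 * M / 2 ^+ j.
Proof.
move=> cf f1 M0 orth.
have cfk (k : nat) : continuous (fun x : R => f (2 ^+ k * x)).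
  exact: continuous_dilation.
have cfkl (k l : nat) : continuous (fun x : R => f (2 ^+ k * x) * f (2 ^+ l * x)).
  by move=> x; apply: cvgM; exact: cfk.
have -> : (fun x => dyadic_mean f j x ^+ 2) = (fun x =>
    (\sum_(k < 2 ^ j) \sum_(l < 2 ^ j) f (2 ^+ k * x) * f (2 ^+ l * x)) *
    (2 ^- j) ^+ 2).
  apply/funext => x; rewrite /dyadic_mean exprMn; congr (_ * _).
  by rewrite expr2 big_distrl/=; apply: eq_bigr => k _; rewrite big_distrr.
rewrite RintegralZr//; last first.
  by apply: continuous_integrable_itv; do 2 apply: continuous_sumr => ?.
rewrite Rintegral_sumr//; last first.
  by move=> k; apply: continuous_integrable_itv; exact: continuous_sumr.
have diag (k : 'I_(2 ^ j)) : \int[lebesgue_measure]_(x in `[- M, M])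
    (\sum_(l < 2 ^ j) f (2 ^+ k * x) * f (2 ^+ l * x)) <= 2 * M.
  rewrite Rintegral_sumr//; last by move=> l; exact: continuous_integrable_itv.
  rewrite (bigD1 k)//= [X in _ + X]big1 ?addr0; last first.
    by move=> l lk; apply: orth; rewrite eq_sym.
  apply: (@le_trans _ _ (\int[lebesgue_measure]_(x in `[- M, M]) (cst 1 x : R))).
    apply: le_Rintegral => //; first exact: continuous_integrable_itv.
      by apply: continuous_integrable_itv; exact: cst_continuous.
    move=> x _; rewrite -expr2 -real_normK ?num_real//.
    by rewrite expr_le1.
  rewrite Rintegral_cst// mul1r le_eqVlt; apply/orP; left; apply/eqP.
  have leb : lebesgue_measure `[- M, M] = (2 * M)%:E.
    by rewrite lebesgue_measure_itv/= lte_fin gtrN// opprK -EFinD mulr_natl mulr2n.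
  by rewrite [X in fine X](_ : _ = (2 * M)%:E).
apply: (@le_trans _ _ (\sum_(k < 2 ^ j) (2 * M) * (2 ^- j) ^+ 2)).
  by rewrite -big_distrl/= ler_wpM2r ?sqr_ge0// ler_sum.
by rewrite sumr_const card_ord -[X in X <= _]mulr_natr natrX expr2 !mulrA mulfVK// expf_neq0.
Qed.

Lemma nneseries_half_lty (R : realType) (r : R) :
  (\sum_(j <oo) (r / 2 ^+ j)%:E < +oo)%E.
Proof.
(* The standard geometric series starts at exponent 1, whence the factor [2 * r]. *)
have -> : (fun n => \sum_(0 <= j < n) (r / 2 ^+ j)%:E)%E =
    eseries (fun j => (2 * r / (2 ^ (j + 1))%:R)%:E).
  apply/funext => n; apply: eq_bigr => j _.
  by rewrite natrX exprD expr1; congr EFin; field; rewrite expf_neq0.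
by rewrite (cvg_lim _ (@cvg_geometric_eseries_half R (2 * r) 0))// ltry.
Qed.

(** Square summability survives a geometrically small perturbation, since
    [u^2 <= 2 v^2 + 2 (u - v)^2]. *)
Lemma nneseries_sqr_close_lty (R : realType) (u v : nat -> R) :
  (forall j, `|u j - v j| <= 2 / 2 ^+ j) ->
  (\sum_(j <oo) (v j ^+ 2)%:E < +oo)%E -> (\sum_(j <oo) (u j ^+ 2)%:E < +oo)%E.
Proof.
move=> uv vfin.
apply: (@le_lt_trans _ _
    (\sum_(j <oo) (2%:E * (v j ^+ 2)%:E + (8 / 2 ^+ j)%:E))%E).
  apply: lee_nneseries => [j _ _|j _]; first by rewrite lee_fin sqr_ge0.
  rewrite -EFinM -EFinD lee_fin.
  (* The natural bound [4 / 4 ^ j] is weakened to reuse the series of ratio one half. *)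
  have d2 : (u j - v j) ^+ 2 <= 4 / 2 ^+ j.
    rewrite -real_normK ?num_real//.
    apply: (@le_trans _ _ ((2 / 2 ^+ j) ^+ 2)).
      by rewrite lerXn2r ?nnegrE ?divr_ge0// exprn_ge0.
    have -> : 4 = 2 ^+ 2 :> R by ring.
    rewrite exprMn ler_wpM2l ?exprn_ge0// exprVn.
    by rewrite lef_pV2 ?posrE ?exprn_gt0// ler_eXnr ?exprn_ege1 ?ler1n.
  (* This square is exactly [2 (u - v)^2 + 2 v^2 - u^2]. *)
  have : 0 <= (u j - 2 * v j) ^+ 2 by rewrite sqr_ge0.
  have -> : 8 / 2 ^+ j = 2 * (4 / 2 ^+ j) :> R by field; rewrite expf_neq0.
  by nra.
rewrite nneseriesD; last 2 first.
- by move=> j _ _; rewrite -EFinM lee_fin mulr_ge0// sqr_ge0.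
- by move=> j _ _; rewrite lee_fin divr_ge0// exprn_ge0.
apply: lte_add_pinfty; last exact: nneseries_half_lty.
rewrite nneseriesZl; last by move=> j _; rewrite lee_fin sqr_ge0.
by rewrite lte_mul_pinfty.
Qed.

(* The sums at [x] and at [(x + d) / 2] are shifts of each other. *)
Lemma dyadic_mean_half (R : realType) (f : R -> R) (d x : R) (j : nat) :
  (forall x, `|f x| <= 1) ->
  (forall (k : nat) y, f (2 ^+ k * (y + d)) = f (2 ^+ k * y)) ->
  `|dyadic_mean f j x - dyadic_mean f j ((x + d) / 2)| <= 2 / 2 ^+ j.
Proof.
move=> f1 fd; rewrite /dyadic_mean -mulrBl normrM normfV.
rewrite (@ger0_norm _ (2 ^+ j)) ?exprn_ge0//.
rewrite ler_wpM2r ?invr_ge0 ?exprn_ge0//.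
pose g k := f (2 ^+ k * ((x + d) / 2)).
have -> : \sum_(k < 2 ^ j) f (2 ^+ k * x) = \sum_(k < 2 ^ j) g k.+1.
  apply: eq_bigr => k _; rewrite /g -fd exprSr; congr f.
  by rewrite -mulrA (mulrC 2) mulfVK.
(* After telescoping only two end terms remain, each of modulus at most 1: hence the constant 2. *)
have e : \sum_(k < 2 ^ j) g k.+1 - \sum_(k < 2 ^ j) g k = g (2 ^ j)%N - g 0%N.
  have rec : \sum_(k < (2 ^ j).+1) g k = \sum_(k < 2 ^ j) g k + g (2 ^ j)%N.
    by rewrite big_ord_recr.
  by move: rec; rewrite big_ord_recl/= => /(congr1 (fun z => z - g 0%N)); lra.
rewrite [X in `|X|]e (le_trans (ler_normB _ _))//.
by have := f1 (2 ^+ (2 ^ j) * ((x + d) / 2)); have := f1 (2 ^+ 0 * ((x + d) / 2));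
  rewrite -/(g 0%N) -/(g (2 ^ j)%N); lra.
Qed.

Lemma dyadic_mean_summable_half (R : realType) (f : R -> R) (d x : R) :
  (forall x, `|f x| <= 1) ->
  (forall (k : nat) y, f (2 ^+ k * (y + d)) = f (2 ^+ k * y)) ->
  dyadic_mean_summable f ((x + d) / 2) <-> dyadic_mean_summable f x.
Proof.
move=> f1 fd; split; rewrite /dyadic_mean_summable/=;
  apply: nneseries_sqr_close_lty => j; last rewrite distrC;
  exact: dyadic_mean_half.
Qed.

Lemma dyadic_mean_summable_cvg0 (R : realType) (f : R -> R) (x : R) :
  dyadic_mean_summable f x -> dyadic_mean f j x @[j --> \oo] --> 0.
Proof.
move=> xfin.
have sq0 : (dyadic_mean f j x ^+ 2) @[j --> \oo] --> 0.
  apply: cvg_series_cvg_0; apply: nnseries_is_cvg => // j; exact: sqr_ge0.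
apply/cvgr0Pnorm_lt => e e0.
have /cvgr0Pnorm_lt/(_ (e ^+ 2)) := sq0.
rewrite exprn_gt0// => /(_ isT); apply: filterS => j.
rewrite normrX => h; have := h; rewrite ltr_sqr ?nnegrE//; exact: ltW.
Qed.

(** On each bounded interval the series of squares has a finite integral, so it is finite almost
    everywhere there; countably many such intervals cover the line. *)
Lemma lebesgue_dyadic_mean_summableC (R : realType) (f : R -> R) :
  continuous f -> (forall x, `|f x| <= 1) ->
  (forall (n k l : nat), k != l -> \int[lebesgue_measure]_(x in `[- n.+1%:R, n.+1%:R])
     (f (2 ^+ k * x) * f (2 ^+ l * x)) = 0) ->
  lebesgue_measure (~` dyadic_mean_summable f) = 0%E.
Proof.
move=> cf f1 orth.
apply: (@measure_negligible _ _ _ lebesgue_measure).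
  by apply: measurableC; exact: measurable_dyadic_mean_summable.
pose S x : \bar R := (\sum_(j <oo) (dyadic_mean f j x ^+ 2)%:E)%E.
have S0 x : (0 <= S x)%E by apply: nneseries_ge0 => j _ _; rewrite lee_fin sqr_ge0.
pose D n : set R := [set` `[- n.+1%:R, n.+1%:R]].
apply: (@negligibleS _ _ _ lebesgue_measure (\bigcup_n [set x | ~ (D n x -> S x \is a fin_num)])).
  move=> x /= xB; exists (Num.truncn `|x|) => //= Dx; apply: xB.
  rewrite /dyadic_mean_summable/= -ge0_fin_numE; last exact: S0.
  by apply: Dx; rewrite /D/= in_itv/= -ler_norml; exact/ltW/truncnS_gt.
apply: negligible_bigcup => n.
apply: (@integrable_ae _ _ _ lebesgue_measure (D n)); first exact: measurable_itv.
apply/integrableP; split.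
  exact: (@measurable_sum_dyadic_mean _ _ _ (measurable_itv _) cf).
under eq_integral do rewrite gee0_abs//.
(* Monotone convergence moves the integral inside the series, where the bound by
   [2 * n.+1%:R / 2 ^+ j] applies termwise. *)
rewrite integral_nneseries//; last 2 first.
- move=> j; apply/measurable_EFinP; apply: measurable_funX.
  by apply: measurable_funTS; exact: measurable_dyadic_mean.
- by move=> j x _; rewrite lee_fin sqr_ge0.
apply: le_lt_trans (@nneseries_half_lty R (2 * n.+1%:R)).
apply: lee_nneseries => [j _ _|j _].
  by apply: integral_ge0 => x _; rewrite lee_fin sqr_ge0.
have ij : lebesgue_measure.-integrable (D n) (EFin \o (fun x => dyadic_mean f j x ^+ 2)).
  apply: continuous_integrable_itv => x.
  by apply: cvgM; exact: continuous_dyadic_mean.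
have /(_ (measurable_itv _)) ifin := fun mD => integrable_fin_num mD ij.
rewrite -[leLHS](fineK ifin).
by rewrite lee_fin; apply: Rintegral_dyadic_mean_sqr_le => //; exact: orth.
Unshelve. all: by [exact: measurable_itv|]. Qed.

(** * Integration against a self-similar probability *)

Lemma bounded_Rintegrable (R : realType) (mu : probability R R) (D : set R)
    (F : R -> R) (c : R) :
  measurable D -> measurable_fun setT F -> (forall x, `|F x| <= c) ->
  mu.-integrable D (EFin \o F).
Proof.
move=> mD mF Fc; apply: measurable_bounded_integrable => //.
- by rewrite (le_lt_trans (probability_le1 mu mD))// ltry.
- exact: measurable_funTS.
- exists c; split; first exact: num_real.
  by move=> M cM x _ /=; rewrite (le_trans (Fc x))// ltW.
Qed.

Lemma Rintegral_bounded_cvg (R : realType) (mu : probability R R) (D : set R)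
    (F : nat -> R -> R) (G : R -> R) :
  measurable D -> (forall n, measurable_fun setT (F n)) ->
  measurable_fun setT G -> (forall n x, `|F n x| <= 1) ->
  (forall x, D x -> F n x @[n --> \oo] --> G x) ->
  \int[mu]_(x in D) F n x @[n --> \oo] --> \int[mu]_(x in D) G x.
Proof.
move=> mD mF mG F1 FG.
have iF n : mu.-integrable D (EFin \o F n).
  exact: (@bounded_Rintegrable _ _ _ _ 1).
have := @dominated_convergence _ _ _ mu D mD (fun n => EFin \o F n) (EFin \o G)
  (cst 1%E).
case.
- by move=> n; apply/measurable_EFinP; exact: measurable_funTS.
- by apply/measurable_EFinP; exact: measurable_funTS.
- by apply: aeW => x Dx; apply: cvg_EFin; [exact: nearW|exact: FG].
- apply: (@bounded_Rintegrable _ _ _ (cst 1) 1) => //.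
  by move=> x; rewrite normr1.
- by apply: aeW => x n Dx /=; rewrite lee_fin.
move=> iG _.
by rewrite -(fineK (integrable_fin_num mD iG)) => /fine_cvgP[].
Qed.

(** This form shows that self-similarity makes [mu] the average of its push-forwards under the maps
    [x |-> (x + d) / 2]. *)
Lemma dil2_preimage (R : realType) (d : R) (A : set R) :
  dil2 d A = (fun x => (x + d) / 2) @^-1` A.
Proof.
apply/seteqP; split=> [_ [x Ax <-]|x Ax] /=.
  by rewrite subrK mulrC mulKf.
by exists ((x + d) / 2) => //; rewrite mulrC mulfVK// addrK.
Qed.

Lemma measurable_half (R : realType) (d : R) :
  measurable_fun [set: R] (fun x => (x + d) / 2).
Proof.
apply: measurable_funM => //; exact: measurable_funD.
Qed.

(** Change of variables in each of the three push-forwards keeps the domain [B], because [B] is its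
    own preimage under each map. *)
Lemma self_similar_Rintegral (R : realType) (c : R) (mu : probability R R)
    (B : set R) (F : R -> R) :
  self_similar_measure c mu -> measurable B ->
  (forall d, d \in [:: 0; 1; c] -> forall x, B ((x + d) / 2) <-> B x) ->
  measurable_fun setT F -> (forall x, `|F x| <= 1) ->
  \int[mu]_(x in B) F x = 3^-1 * (\int[mu]_(x in B) F ((x + 0) / 2) +
    \int[mu]_(x in B) F ((x + 1) / 2) + \int[mu]_(x in B) F ((x + c) / 2)).
Proof.
move=> ss mB Bhalf mF F1.
pose h (d x : R) := (x + d) / 2.
have mh d : measurable_fun setT (h d) by exact: measurable_half.
have hB d : d \in [:: 0; 1; c] -> h d @^-1` B = B.
  by move=> dc; apply/seteqP; split=> x /(Bhalf d dc).
have iF : mu.-integrable B (EFin \o F) by exact: (@bounded_Rintegrable _ _ _ _ 1).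
have iFh d : mu.-integrable B (EFin \o (F \o h d)).
  apply: (@bounded_Rintegrable _ _ _ _ 1) => // [|x]; last exact: F1.
  exact: measurableT_comp.
have mEF : measurable_fun setT (EFin \o F) by exact/measurable_EFinP.
pose nu e : {measure set R -> \bar R} :=
  measure_function_pushforward__canonical__measure_function_Measure mu (mh e).
have inu e : e \in [:: 0; 1; c] -> (nu e).-integrable B (EFin \o F).
  move=> ec; apply: integrable_pushforward => //.
  by rewrite hB//; exact: iFh.
have nuE e : e \in [:: 0; 1; c] ->
    (\int[nu e]_(x in B) (F x)%:E = \int[mu]_(x in B) (F (h e x))%:E)%E.
  by move=> ec; rewrite integral_pushforward// hB//; exact: iFh.
have iadd (m1 m2 : {measure set R -> \bar R}) : m1.-integrable B (EFin \o F) ->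
    m2.-integrable B (EFin \o F) -> (measure_add m1 m2).-integrable B (EFin \o F).
  move=> /integrableP[mBF i1] /integrableP[_ i2]; apply/integrableP; split => //.
  rewrite ge0_integral_measure_add//; first exact: lte_add_pinfty.
  exact: measurableT_comp.
have [i0 i1 ic] : [/\ (0 : R) \in [:: 0; 1; c], (1 : R) \in [:: 0; 1; c] & c \in [:: 0; 1; c]].
  by rewrite !inE !eqxx !orbT.
have mBF : measurable_fun B (EFin \o F) by exact: measurable_funTS.
(* The equation is multiplied by 3, so that only sums of measures are compared. *)
have key : (\int[measure_add (measure_add mu mu) mu]_(x in B) (EFin \o F) x =
    \int[measure_add (measure_add (nu 0%R) (nu 1%R)) (nu c)]_(x in B) (EFin \o F) x)%E.
  apply: eq_measure_integral => A mA _.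
  have e (m1 m2 m3 : {measure set R -> \bar R}) :
      measure_add (measure_add m1 m2) m3 A = (m1 A + m2 A + m3 A)%E.
    by rewrite measure_addE; congr (_ + _)%E; exact: measure_addE.
  apply: (eq_trans (e _ _ _)); apply: (eq_trans _ (esym (e _ _ _))).
  rewrite /nu/= /pushforward -/(h 0) -!dil2_preimage ss//.
  rewrite -!ge0_muleDl ?lee_fin ?addr_ge0// -!EFinD.
  by rewrite (_ : 3^-1 + 3^-1 + 3^-1 = 1) ?mul1e//; field.
rewrite !integral_measure_add// in key; try exact: inu; try exact: iadd;
  try by apply: iadd; exact: inu.
have RE (G : R -> R) : mu.-integrable B (EFin \o G) ->
    (\int[mu]_(x in B) (G x)%:E)%E = (\int[mu]_(x in B) G x)%:E.
  by move=> iG; rewrite /Rintegral fineK//; exact: integrable_fin_num.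
move: key; rewrite (nuE 0)// (nuE 1)// (nuE c)//.
rewrite !RE ?iFh// -!EFinD => -[].
rewrite /h; lra.
Qed.

(** * The Fourier transform of [mu] restricted to [B] *)

Definition cos_wave {R : realType} (t a x : R) : R := cos (t * x - a).

Lemma cos_wave_norm_le1 (R : realType) (t a x : R) : `|cos_wave t a x| <= 1.
Proof. exact: cos_max. Qed.

Lemma measurable_cos_wave (R : realType) (t a : R) :
  measurable_fun [set: R] (cos_wave t a).
Proof. by apply: continuous_measurable_fun; exact: continuous_cos_affine. Qed.

(* [char_cos mu B t 0] and [char_cos mu B t (pi / 2)] are the real and imaginary
   parts of the Fourier transform at [t] of [mu] restricted to [B]. *)
Definition char_cos {R : realType} (mu : probability R R) (B : set R) (t a : R) : R :=
  \int[mu]_(x in B) cos_wave t a x.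

Section char_cos.
Variables (R : realType) (mu : probability R R) (B : set R).
Hypothesis mB : measurable B.

Lemma integrable_cos_wave (t a : R) : mu.-integrable B (EFin \o cos_wave t a).
Proof.
by apply: (@bounded_Rintegrable _ _ _ _ 1) => //;
  [exact: measurable_cos_wave|exact: cos_wave_norm_le1].
Qed.

(** The addition formula for [cos (t * x - a)] reduces every phase to the real and imaginary
    parts. *)
Lemma char_cosE (t a : R) :
  char_cos mu B t a = cos a * char_cos mu B t 0 + sin a * char_cos mu B t (pi / 2).
Proof.
rewrite /char_cos -!RintegralZl//; try exact: integrable_cos_wave.
rewrite -RintegralD//; last 2 first.
- exact: (integrableZl mB (cos a) (integrable_cos_wave t 0)).
- exact: (integrableZl mB (sin a) (integrable_cos_wave t (pi / 2))).
apply: eq_Rintegral => x _; rewrite /cos_wave subr0 cosBpihalf cosB; ring.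
Qed.

(** Continuity of the transform at the origin, where its value is the mass of [B]. *)
Lemma char_cos_cvg0 (t : R) :
  char_cos mu B (t / 2 ^+ m) 0 @[m --> \oo] --> fine (mu B).
Proof.
have -> : fine (mu B) = \int[mu]_(x in B) 1 by rewrite Rintegral_cst// mul1r.
apply: Rintegral_bounded_cvg => //.
- by move=> m; exact: measurable_cos_wave.
- by move=> m x; exact: cos_wave_norm_le1.
move=> x _; rewrite /cos_wave.
have z0 : t / 2 ^+ m * x - 0 @[m --> \oo] --> 0.
  rewrite -[X in _ --> X](mulr0 (t * x)).
  have -> : (fun m => t / 2 ^+ m * x - 0) = (fun m => t * x * 2^-1 ^+ m).
    by apply/funext => m; rewrite subr0 mulrAC exprVn.
  apply: cvgM; first exact: cvg_cst.
  by apply: cvg_expr; rewrite ger0_norm// invf_lt1// ltr1n.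
have := @continuous_cvg _ _ _ _ _ _ cos _ (@continuous_cos R 0) z0.
by rewrite cos0; apply; exact: eventually_filter.
Qed.

Variable c : R.
Hypothesis ss : self_similar_measure c mu.
Hypothesis Bhalf : forall d, d \in [:: 0; 1; c] -> forall x, B ((x + d) / 2) <-> B x.

(** At [(x + d) / 2] the wave of frequency [2 * t] becomes a wave of frequency [t] with phase
    [a - t * d]. *)
Lemma char_cos_double (t a : R) :
  char_cos mu B (2 * t) a = 3^-1 * (char_cos mu B t a +
    char_cos mu B t (a - t) + char_cos mu B t (a - t * c)).
Proof.
rewrite /char_cos (@self_similar_Rintegral _ _ _ _ _ ss mB Bhalf); last 2 first.
- exact: measurable_cos_wave.
- exact: cos_wave_norm_le1.
by congr (_ * (_ + _ + _)); apply: eq_Rintegral => x _; congr cos; field.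
Qed.

Lemma char_cos_double_periodic (t a : R) :
  (forall y, cos (y + t) = cos y) -> (forall y, cos (y + t * c) = cos y) ->
  char_cos mu B (2 * t) a = char_cos mu B t a.
Proof.
move=> t1 tc; rewrite char_cos_double.
have shift u : (forall y, cos (y + u) = cos y) ->
    char_cos mu B t (a - u) = char_cos mu B t a.
  by move=> cu; apply: eq_Rintegral => x _; rewrite /cos_wave opprB addrCA addrC cu.
by rewrite !shift//; field.
Qed.

(** The squared modulus of the transform, which turns the complex doubling relation into a real
    one. *)
Let power (t : R) := char_cos mu B t 0 ^+ 2 + char_cos mu B t (pi / 2) ^+ 2.

(** Multiplicativity of the modulus: the factor is the squared modulus of
    [(1 + e^(it) + e^(itc)) / 3]. *)
Lemma char_cos_power_double (t : R) :
  power (2 * t) = ((1 + cos t + cos (t * c)) ^+ 2 + (sin t + sin (t * c)) ^+ 2) / 9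
                  * power t.
Proof.
rewrite /power !char_cos_double.
rewrite (char_cosE t (0 - t)) (char_cosE t (0 - t * c)).
rewrite (char_cosE t (pi / 2 - t)) (char_cosE t (pi / 2 - t * c)).
rewrite !sub0r !cosN !sinN !cosB !sinB cos_pihalf sin_pihalf.
by field.
Qed.

End char_cos.

(** * Zeros of the doubling factor, orthogonality of waves, vanishing of the transform *)

Lemma cos_add_unit_eq0 (R : realType) (a b : R) :
  1 + cos a + cos b = 0 -> sin a + sin b = 0 -> cos a = - 2^-1.
Proof.
move=> h1 h2; have ha := cos2Dsin2 a; have hb := cos2Dsin2 b.
have {}h1 : cos b = - 1 - cos a by lra.
have {}h2 : sin b = - sin a by lra.
(* The point [- 1 - e^(ia)] lies on the unit circle, which expands to [2 + 2 cos a = 1]. *)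
rewrite h1 h2 in hb.
have : cos a * 2 = - 1 by nra.
lra.
Qed.

(** The value [- 2^-1] is a fixed point of [y |-> 2 y^2 - 1]. *)
Lemma cos_pow2_mul (R : realType) (a : R) (i : nat) :
  cos a = - 2^-1 -> cos (2 ^+ i * a) = - 2^-1.
Proof.
move=> ca; elim: i => [|i IH]; first by rewrite expr0 mul1r.
rewrite exprS -mulrA mulr_natl cos_mulr2n IH; lra.
Qed.

(** The product is half a sum of waves of frequencies [w * (2^k + 2^l)] and [w * (2^k - 2^l)]. Both
    are nonzero, and being multiples of [2 * pi] they have vanishing sine at integer endpoints. *)
Lemma cos_wave_orthogonal (R : realType) (q n k l : nat) (a : R) :
  (0 < q)%N -> k != l ->
  \int[lebesgue_measure]_(x in `[- n.+1%:R, n.+1%:R])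
    (cos_wave (2 * pi * q%:R) a (2 ^+ k * x) *
     cos_wave (2 * pi * q%:R) a (2 ^+ l * x)) = 0.
Proof.
move=> q0 kl; pose w : R := 2 * pi * q%:R.
have w0 : 0 < w by rewrite !mulr_gt0 ?pi_gt0 ?ltr0n.
pose tp := w * 2 ^+ k + w * 2 ^+ l; pose tm := w * 2 ^+ k - w * 2 ^+ l.
have tp0 : tp != 0 by rewrite gt_eqF// addr_gt0// mulr_gt0// exprn_gt0.
have tm0 : tm != 0.
  rewrite /tm -mulrBr; apply: mulf_neq0; first by rewrite gt_eqF.
  rewrite subr_eq0.
  by rewrite -!natrX eqr_nat eqn_exp2l.
have sw i : sin (w * 2 ^+ i * n.+1%:R) = 0.
  have -> : w * 2 ^+ i * n.+1%:R = 2 * pi * (q * 2 ^ i * n.+1)%:R.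
    by rewrite /w !natrM natrX; ring.
  exact: sin2pin.
have stp : sin (tp * n.+1%:R) = 0 by rewrite mulrDl sinD !sw; ring.
have stm : sin (tm * n.+1%:R) = 0 by rewrite mulrBl sinB !sw; ring.
under eq_Rintegral => x _.
  have -> : cos_wave w a (2 ^+ k * x) * cos_wave w a (2 ^+ l * x) =
      2^-1 * (cos (tp * x - 2 * a) + cos (tm * x - 0)).
    have -> : tp * x - 2 * a = (w * (2 ^+ k * x) - a) + (w * (2 ^+ l * x) - a).
      by rewrite /tp; ring.
    have -> : tm * x - 0 = (w * (2 ^+ k * x) - a) - (w * (2 ^+ l * x) - a).
      by rewrite /tm; ring.
    rewrite /cos_wave; set u := w * _ - a; set v := w * _ - a.
    by rewrite (cosD u v) (cosB u v); field.
  over.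
have ci (t b : R) : continuous (fun x => cos (t * x - b)).
  exact: continuous_cos_affine.
rewrite RintegralZl//; last first.
  by apply: continuous_integrable_itv => x; apply: cvgD; exact: ci.
rewrite RintegralD//; try exact: continuous_integrable_itv.
by rewrite !integral_cos_affine_eq0// addr0 mulr0.
Qed.

(** Every dyadic mean of the wave integrates over [B] to the common value at the frequencies
    [w * 2 ^+ k], while on [B] the means tend to 0 and stay bounded by 1. *)
Lemma char_cos_summable_eq0 (R : realType) (mu : probability R R) (B : set R)
    (w a : R) :
  measurable B -> B `<=` dyadic_mean_summable (cos_wave w a) ->
  (forall k : nat, char_cos mu B (w * 2 ^+ k) a = char_cos mu B w a) ->
  char_cos mu B w a = 0.
Proof.
move=> mB BS Jk; set f := cos_wave w a.
have cf : continuous f by exact: continuous_cos_affine.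
have iE j : \int[mu]_(x in B) dyadic_mean f j x = char_cos mu B w a.
  have mfk (k : 'I_(2 ^ j)) : mu.-integrable B (EFin \o (fun x => f (2 ^+ k * x))).
    apply: (@bounded_Rintegrable _ _ _ _ 1) => //; last first.
      by move=> x; exact: cos_wave_norm_le1.
    by apply: continuous_measurable_fun; exact: continuous_dilation.
  rewrite /dyadic_mean RintegralZr//; last exact: integrable_sumr.
  rewrite Rintegral_sumr// (eq_bigr (fun=> char_cos mu B w a)).
    by rewrite sumr_const card_ord -[X in X / _]mulr_natr natrX mulfK// expf_neq0.
  move=> k _; rewrite -(Jk k) /char_cos; apply: eq_Rintegral => x _.
  by rewrite /f /cos_wave mulrA.
have : \int[mu]_(x in B) dyadic_mean f j x @[j --> \oo] --> \int[mu]_(x in B) (0 : R).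
  apply: Rintegral_bounded_cvg => //.
  - by move=> j; exact: measurable_dyadic_mean.
  - by move=> j x; apply: dyadic_mean_norm_le1; exact: cos_wave_norm_le1.
  - by move=> x /BS; exact: dyadic_mean_summable_cvg0.
rewrite Rintegral_cst// mul0r.
under eq_fun do rewrite iE.
move=> h; apply: (@cvg_unique R _ _ _ _ _ _ h).
- exact: norm_hausdorff.
- exact: cvg_cst.
Qed.

(** * A set of full Lebesgue measure and zero [mu]-mass *)

Theorem theorem4p1 (R : realType) (p q : nat) :
  coprime p q -> (0 < q)%N -> (p <= q)%N ->
  forall mu : probability R R,
    self_similar_measure (p%:R / q%:R) mu ->
    singular_wrt_lebesgue mu.
Proof.
move=> _ q0 _ mu ss.
set c : R := p%:R / q%:R in ss.
pose w : R := 2 * pi * q%:R.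
have qR0 : q%:R != 0 :> R by rewrite pnatr_eq0 -lt0n.
have wd d : d \in [:: 0; 1; c] -> exists n : nat, w * d = 2 * pi * n%:R.
  rewrite !inE => /or3P[] /eqP ->.
  - by exists 0%N; rewrite !mulr0.
  - by exists q; rewrite mulr1.
  - by exists p; rewrite /w /c; field.
have wkd (k : nat) d y : d \in [:: 0; 1; c] -> cos (y + w * 2 ^+ k * d) = cos y.
  move=> /wd[n wdn].
  rewrite (_ : w * 2 ^+ k * d = 2 * pi * (n * 2 ^ k)%:R) ?cosD2pin//.
  by rewrite mulrAC wdn natrM natrX; ring.
pose f a := cos_wave w a.
have cf a : continuous (f a) by exact: continuous_cos_affine.
have f1 a x : `|f a x| <= 1 by exact: cos_wave_norm_le1.
(* The phases [0] and [pi / 2] control the real and the imaginary part of the transform. *)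
pose B : set R := dyadic_mean_summable (f 0) `&` dyadic_mean_summable (f (pi / 2)).
have mB : measurable B by apply: measurableI; exact: measurable_dyadic_mean_summable.
have fper a d : d \in [:: 0; 1; c] ->
    forall (k : nat) y, f a (2 ^+ k * (y + d)) = f a (2 ^+ k * y).
  move=> dc k y; rewrite /f /cos_wave -[in RHS](@wkd k d)//; congr cos; ring.
have Bhalf d : d \in [:: 0; 1; c] -> forall x, B ((x + d) / 2) <-> B x.
  move=> dc x.
  have H a := @dyadic_mean_summable_half _ (f a) d x (f1 a) (fper a d dc).
  by split=> -[/H ? /H ?]; split.
have [i1 ic] : 1 \in [:: 0; 1; c] /\ c \in [:: 0; 1; c] by rewrite !inE !eqxx !orbT.
have Jk a (k : nat) : char_cos mu B (w * 2 ^+ k) a = char_cos mu B w a.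
  elim: k => [|k <-]; first by rewrite expr0 mulr1.
  rewrite exprS mulrCA (@char_cos_double_periodic _ _ _ mB _ ss Bhalf)// => y.
    by rewrite -[w * _]mulr1 wkd.
  by rewrite wkd.
have J0 : char_cos mu B w 0 = 0.
  by apply: char_cos_summable_eq0 => // x [].
have J1 : char_cos mu B w (pi / 2) = 0.
  by apply: char_cos_summable_eq0 => // x [].
pose power t := char_cos mu B t 0 ^+ 2 + char_cos mu B t (pi / 2) ^+ 2.
(* The factor relating [power (2 * t)] to [power t] does not vanish at
   [t = w / 2 ^ m.+1]: it could only do so if [cos t = - 1 / 2], a value which
   is stable under doubling of the angle, whereas [cos w = 1]. *)
have powerw (m : nat) : power (w / 2 ^+ m) = 0.
  elim: m => [|m IH]; first by rewrite /power expr0 divr1 J0 J1; ring.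
  set t := w / 2 ^+ m.+1.
  have t2 : w / 2 ^+ m = 2 * t by rewrite /t exprS; field; rewrite expf_neq0.
  move: IH; rewrite t2 /power (@char_cos_power_double _ _ _ mB _ ss Bhalf).
  move=> /eqP; rewrite mulf_eq0 => /orP[|/eqP//].
  rewrite mulf_eq0 invr_eq0 pnatr_eq0 orbF paddr_eq0 ?sqr_ge0//.
  rewrite !sqrf_eq0 => /andP[/eqP h1 /eqP h2].
  have := @cos_pow2_mul _ _ m.+1 (@cos_add_unit_eq0 _ _ _ h1 h2).
  rewrite /t mulrCA mulfV ?expf_neq0// mulr1 /w cos2pin; lra.
have muB : fine (mu B) = 0.
  (* A vanishing sum of two squares kills the real part, and the limit of the real parts is the mass
     of [B]. *)
  have J0m (m : nat) : char_cos mu B (w / 2 ^+ m) 0 = 0.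
    by apply/eqP; have /eqP := powerw m; rewrite paddr_eq0 ?sqr_ge0// !sqrf_eq0 => /andP[].
  have := @char_cos_cvg0 R mu B mB w; under eq_fun do rewrite J0m.
  move=> h; apply/esym; apply: (@cvg_unique R _ _ _ _ _ _ h).
  - exact: norm_hausdorff.
  - exact: cvg_cst.
(* The complement of [B] is Lebesgue null and carries all the mass of [mu]. *)
exists (~` B); split; first exact: measurableC.
- have null a : lebesgue_measure (~` dyadic_mean_summable (f a)) = 0%E.
    by apply: lebesgue_dyadic_mean_summableC => // n k l kl; exact: cos_wave_orthogonal.
  rewrite setCI; apply/eqP; rewrite eq_le measure_ge0 andbT.
  apply: (le_trans (measureU2 _ _ _)).
  - by apply: measurableC; exact: measurable_dyadic_mean_summable.
  - by apply: measurableC; exact: measurable_dyadic_mean_summable.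
  rewrite le_eqVlt; apply/orP; left; apply/eqP.
  by rewrite -[RHS]adde0; congr (_ + _)%E; exact: null.
- by rewrite setCK -(fineK (fin_num_measure mu _ mB)) muB.
Qed.
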